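(* Let $G$ be one of the ten groups (S1)–(S10) of order $2^6$ listed in the context. Then $I_{\min}=1$. Moreover: (1) If $I_{\max}=3$, then $G$ is one of: (S1)–(S2), (S5)–(S6). (2) If $I_{\max}=2$, then $G$ is one of: (S3)–(S4), (S7)–(S9). (3) If $I_{\max}=1$, then $G$ is (S10).
   Context: An $\mathcal{A}_1$-group is a minimal non-abelian group (non-abelian with all proper subgroups abelian). For a finite $2$-group $G$, $2^{I_{\min}}$ and $2^{I_{\max}}$ denote respectively the minimal and the maximal index in $G$ of $\mathcal{A}_1$-subgroups of $G$. Commutators: $[g,h]=g^{-1}h^{-1}gh$. The groups are: (S1) $\langle a,b,c,d,e,f \mid a^{2}=b^{2}=c^{2}=d^2=e^2=f^2=1,\ [b,c]=d,\ [c,a]=e,\ [a,b]=f,\ [d,a]=[d,b]=[d,c]=[e,a]=[e,b]=[e,c]=[f,a]=[f,b]=[f,c]=1\rangle$; (S2) $\langle a,b,c,d,e \mid a^{2}=b^{2}=c^{4}=d^2=e^2=1,\ [b,c]=d,\ [c,a]=e,\ [a,b]=c^2,\ [d,a]=[d,b]=[d,c]=[e,a]=[e,b]=[e,c]=1\rangle$; (S3) $\langle a,b,c,d \mid a^{4}=b^{4}=c^{2}=d^2=1,\ [b,c]=d,\ [c,a]=a^2b^2,\ [a,b]=b^2,\ [d,a]=[d,b]=[d,c]=1\rangle$; (S4) $\langle a,b,c,d \mid a^{4}=b^{4}=c^{2}=d^2=1,\ [b,c]=d,\ [c,a]=a^2b^2,\ [a,b]=a^2,\ [d,a]=[d,b]=[d,c]=1\rangle$;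 (S5) $\langle a,b,c,d,e \mid a^{4}=b^{4}=c^{2}=d^2=e^2=1,\ [b,c]=d,\ [c,a]=e,\ [a,b]=a^2=b^2,\ [d,a]=[d,b]=[d,c]=[e,a]=[e,b]=[e,c]=1\rangle$; (S6) $\langle a,b,c,d,e \mid a^{4}=b^{4}=c^{4}=d^2=e^2=1,\ [b,c]=d,\ [c,a]=e,\ [a,b]=a^2=b^2=c^2,\ [d,a]=[d,b]=[d,c]=[e,a]=[e,b]=[e,c]=1\rangle$; (S7) $\langle a,b,c,d \mid a^{4}=b^{2}=c^{4}=d^2=1,\ [b,c]=d,\ [c,a]=a^2,\ [a,b]=c^2,\ [d,a]=[d,b]=[d,c]=1\rangle$; (S8) $\langle a,b,c,d \mid a^{4}=b^{4}=c^{4}=d^2=1,\ [b,c]=d,\ [c,a]=a^2,\ [a,b]=b^2=c^2,\ [d,a]=[d,b]=[d,c]=1\rangle$; (S9) $\langle a,b,c,d \mid a^{4}=b^{4}=c^{4}=d^2=1,\ [b,c]=d,\ [c,a]=a^2b^2,\ [a,b]=a^2=c^2,\ [d,a]=[d,b]=[d,c]=1\rangle$; (S10) $\langle a,b,c \mid a^{4}=b^{4}=c^{4}=1,\ [b,c]=a^2b^2,\ [c,a]=b^2c^2,\ [a,b]=c^2,\ [c^2,a]=[c^2,b]=1\rangle$. *)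

(* Defs.v *)
From mathcomp Require Import all_boot all_fingroup.

Set Implicit Arguments.
Unset Strict Implicit.
Unset Printing Implicit Defensive.

Local Open Scope group_scope.

Definition A1_group (gT : finGroupType) (G : {group gT}) : Prop :=
  ~~ abelian G /\ forall H : {group gT}, H \proper G -> abelian H.

Definition A1_index (gT : finGroupType) (G : {group gT}) (m : nat) : Prop :=
  exists H : {group gT}, [/\ H \subset G, A1_group H & #|G : H| = m].

(* I_min and I_max are given as relations, since they have no value when G has
   no A_1-subgroup (that is, when G is abelian); n is unique when it exists. *)
Definition is_Imin (gT : finGroupType) (G : {group gT}) (n : nat) : Prop :=
  A1_index G (2 ^ n)%N /\ forall m, A1_index G m -> (2 ^ n <= m)%N.

Definition is_Imax (gT : finGroupType) (G : {group gT}) (n : nat) : Prop :=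
  A1_index G (2 ^ n)%N /\ forall m, A1_index G m -> (m <= 2 ^ n)%N.

(* [~ g, h] is g^-1 * h^-1 * g * h in MathComp.  In Grp (...) an isolated term
   s stands for the relation s = 1.  The presentations below define finite
   groups (each of order 64), so \isog Grp means isomorphic to the presented
   group. *)
Definition S1 (gT : finGroupType) (G : {group gT}) : Prop :=
  G \isog Grp (a : b : c : d : e : f :
    a ^+ 2, b ^+ 2, c ^+ 2, d ^+ 2, e ^+ 2, f ^+ 2,
    [~ b, c] = d, [~ c, a] = e, [~ a, b] = f,
    [~ d, a], [~ d, b], [~ d, c], [~ e, a], [~ e, b], [~ e, c],
    [~ f, a], [~ f, b], [~ f, c]).

Definition S2 (gT : finGroupType) (G : {group gT}) : Prop :=
  G \isog Grp (a : b : c : d : e :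
    a ^+ 2, b ^+ 2, c ^+ 4, d ^+ 2, e ^+ 2,
    [~ b, c] = d, [~ c, a] = e, [~ a, b] = c ^+ 2,
    [~ d, a], [~ d, b], [~ d, c], [~ e, a], [~ e, b], [~ e, c]).

Definition S3 (gT : finGroupType) (G : {group gT}) : Prop :=
  G \isog Grp (a : b : c : d :
    a ^+ 4, b ^+ 4, c ^+ 2, d ^+ 2,
    [~ b, c] = d, [~ c, a] = a ^+ 2 * b ^+ 2, [~ a, b] = b ^+ 2,
    [~ d, a], [~ d, b], [~ d, c]).

Definition S4 (gT : finGroupType) (G : {group gT}) : Prop :=
  G \isog Grp (a : b : c : d :
    a ^+ 4, b ^+ 4, c ^+ 2, d ^+ 2,
    [~ b, c] = d, [~ c, a] = a ^+ 2 * b ^+ 2, [~ a, b] = a ^+ 2,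
    [~ d, a], [~ d, b], [~ d, c]).

Definition S5 (gT : finGroupType) (G : {group gT}) : Prop :=
  G \isog Grp (a : b : c : d : e :
    a ^+ 4, b ^+ 4, c ^+ 2, d ^+ 2, e ^+ 2,
    [~ b, c] = d, [~ c, a] = e, [~ a, b] = a ^+ 2, a ^+ 2 = b ^+ 2,
    [~ d, a], [~ d, b], [~ d, c], [~ e, a], [~ e, b], [~ e, c]).

Definition S6 (gT : finGroupType) (G : {group gT}) : Prop :=
  G \isog Grp (a : b : c : d : e :
    a ^+ 4, b ^+ 4, c ^+ 4, d ^+ 2, e ^+ 2,
    [~ b, c] = d, [~ c, a] = e,
    [~ a, b] = a ^+ 2, a ^+ 2 = b ^+ 2, b ^+ 2 = c ^+ 2,
    [~ d, a], [~ d, b], [~ d, c], [~ e, a], [~ e, b], [~ e, c]).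

Definition S7 (gT : finGroupType) (G : {group gT}) : Prop :=
  G \isog Grp (a : b : c : d :
    a ^+ 4, b ^+ 2, c ^+ 4, d ^+ 2,
    [~ b, c] = d, [~ c, a] = a ^+ 2, [~ a, b] = c ^+ 2,
    [~ d, a], [~ d, b], [~ d, c]).

Definition S8 (gT : finGroupType) (G : {group gT}) : Prop :=
  G \isog Grp (a : b : c : d :
    a ^+ 4, b ^+ 4, c ^+ 4, d ^+ 2,
    [~ b, c] = d, [~ c, a] = a ^+ 2, [~ a, b] = b ^+ 2, b ^+ 2 = c ^+ 2,
    [~ d, a], [~ d, b], [~ d, c]).

Definition S9 (gT : finGroupType) (G : {group gT}) : Prop :=
  G \isog Grp (a : b : c : d :
    a ^+ 4, b ^+ 4, c ^+ 4, d ^+ 2,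
    [~ b, c] = d, [~ c, a] = a ^+ 2 * b ^+ 2,
    [~ a, b] = a ^+ 2, a ^+ 2 = c ^+ 2,
    [~ d, a], [~ d, b], [~ d, c]).

Definition S10 (gT : finGroupType) (G : {group gT}) : Prop :=
  G \isog Grp (a : b : c :
    a ^+ 4, b ^+ 4, c ^+ 4,
    [~ b, c] = a ^+ 2 * b ^+ 2, [~ c, a] = b ^+ 2 * c ^+ 2,
    [~ a, b] = c ^+ 2, [~ c ^+ 2, a], [~ c ^+ 2, b]).

(* Main.v *)
(** Let Z = <d, e, f> with d = [b, c], e = [c, a] and f = [a, b].  In each of
    the ten groups Z is central and elementary abelian, contains a^2, b^2 and
    c^2, and has d, e, f as a basis; so the group is determined by the
    coordinates of the three squares, and it is a central extension of F_2^3 by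
    F_2^3 with an explicit bilinear cocycle.  In such an extension
    Phi(H) <= Z(H) for every subgroup H, hence any two non-commuting elements
    x, y generate an A_1-group, and a non-abelian subgroup containing x and y
    has order at least 4 |<x^2, y^2, [x, y]>|.  As x^2, y^2 and [x, y] only
    depend on the images of x and y in F_2^3, the possible indices are found by
    a finite check. *)

Require Import Defs.
From HB Require Import structures.
From mathcomp Require Import all_boot all_fingroup ssralg ring.
From mathcomp Require Import cyclic pgroup center commutator gseries abelian.
From mathcomp Require Import maximal.

Set Implicit Arguments.
Unset Strict Implicit.
Unset Printing Implicit Defensive.

Local Open Scope group_scope.

(** * The central extension of F_2^3 by F_2^3 with prescribed squares *)

Definition F2_3 : Type := bool * bool * bool.

Notation v000 := ((false, false, false) : F2_3).
Notation v100 := ((true, false, false) : F2_3).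
Notation v010 := ((false, true, false) : F2_3).
Notation v001 := ((false, false, true) : F2_3).
Notation v011 := ((false, true, true) : F2_3).
Notation v111 := ((true, true, true) : F2_3).

Section CentralExtension.

Local Open Scope ring_scope.

(* [((i, j, k), (p, q, r)) : model s] stands for a^i b^j c^k d^p e^q f^r, and
   [s] lists the coordinates of a^2, b^2, c^2 in the basis d, e, f. *)
Definition model (s : F2_3 * F2_3 * F2_3) : Type := F2_3 * F2_3.

HB.instance Definition _ s := Finite.on (model s).

Variable s : F2_3 * F2_3 * F2_3.

(** The correction terms come from collecting a product of two normal words: moving a letter to the
    left past a later one produces d, e or f, whence [k * j'], [k * i'] and [j * i']; two equal
    letters combine into a square, whence the terms with coefficients from [s]. These terms are
    bilinear in the first components, so associativity is a polynomial identity. *)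
Definition model_mul (x y : model s) : model s :=
  let: ((i, j, k), (d, e, f)) := x in
  let: ((i', j', k'), (d', e', f')) := y in
  let: ((da, ea, fa), (db, eb, fb), (dc, ec, fc)) := s in
  ((i + i', j + j', k + k'),
   (d + d' + (k * j' + i * i' * da + j * j' * db + k * k' * dc),
    e + e' + (k * i' + i * i' * ea + j * j' * eb + k * k' * ec),
    f + f' + (j * i' + i * i' * fa + j * j' * fb + k * k' * fc))).

Definition model_one : model s := ((0, 0, 0), (0, 0, 0)).

(** For a bilinear cocycle B the inverse of (v, w) is (-v, -w + B(v, v)). The signs, trivial over
    F_2, make the inverse law an identity valid in every commutative ring, within reach of
    [ring]. *)
Definition model_inv (x : model s) : model s :=
  let: ((i, j, k), (d, e, f)) := x in
  let: ((da, ea, fa), (db, eb, fb), (dc, ec, fc)) := s in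
  ((- i, - j, - k),
   (- d + (k * j + i * i * da + j * j * db + k * k * dc),
    - e + (k * i + i * i * ea + j * j * eb + k * k * ec),
    - f + (j * i + i * i * fa + j * j * fb + k * k * fc))).

Lemma model_mulA : associative model_mul.
Proof.
case=> [[[i j] k] [[d e] f]] [[[i' j'] k'] [[d' e'] f']] [[[l m] n] [[p q] r]].
rewrite /model_mul /model; case: s => -[[[da ea] fa] [[db eb] fb]] [[dc ec] fc].
by congr ((_, _, _), (_, _, _)); ring.
Qed.

Lemma model_mul1 : left_id model_one model_mul.
Proof.
case=> [[[i j] k] [[d e] f]]; rewrite /model_one /model_mul /model.
case: s => -[[[da ea] fa] [[db eb] fb]] [[dc ec] fc].
by congr ((_, _, _), (_, _, _)); ring.
Qed.

Lemma model_mulV : left_inverse model_one model_inv model_mul.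
Proof.
case=> [[[i j] k] [[d e] f]]; rewrite /model_one /model_inv /model_mul /model.
case: s => -[[[da ea] fa] [[db eb] fb]] [[dc ec] fc].
by congr ((_, _, _), (_, _, _)); ring.
Qed.

End CentralExtension.

HB.instance Definition _ s :=
  Finite_isGroup.Build (model s)
    (@model_mulA s) (@model_mul1 s) (@model_mulV s).

(** * Collection of words and the morphism from the model *)

Lemma commuteX2A (gT : finGroupType) (x y : gT) m n z :
  commute x y -> y ^+ n * (x ^+ m * z) = x ^+ m * (y ^+ n * z).
Proof. by move=> cxy; rewrite !mulgA (commuteX2 m n cxy). Qed.

Lemma expg_addb (gT : finGroupType) (x : gT) (m n : bool) :
  x ^+ 2 = 1 -> x ^+ m * x ^+ n = x ^+ (m (+) n).
Proof. by case: m n => [] [] /= x2; rewrite ?mulg1 ?mul1g. Qed.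

Lemma invg_of_expg2 (gT : finGroupType) (x : gT) : x ^+ 2 = 1 -> x^-1 = x.
Proof. by rewrite expg2 => /eqP; rewrite -eq_invg_mul => /eqP. Qed.

(** The basic collection step: since [x, y] has order at most 2, [y, x] = [x, y], so exchanging y
    and x leaves a factor [x, y] behind. *)
Lemma expg_swapA (gT : finGroupType) (x y : gT) (m n : bool) z :
    commute x [~ x, y] -> commute y [~ x, y] -> [~ x, y] ^+ 2 = 1 ->
  y ^+ m * (x ^+ n * z) = x ^+ n * (y ^+ m * ([~ x, y] ^+ (m && n) * z)).
Proof.
set t := [~ x, y] => xt yt t2; have yx : y * x = x * y * t.
  by rewrite commgC; congr (_ * _); rewrite -invgR invg_of_expg2.
clearbody t; case: m n => [] [] /=; rewrite ?expg1 ?expg0 ?mul1g //.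
by rewrite !mulgA yx.
Qed.

Section ModelHom.

Variables (gT : finGroupType) (a b c d e f : gT).

Definition central_word (w : F2_3) : gT :=
  let: (p, q, r) := w in d ^+ p * (e ^+ q * f ^+ r).

Lemma central_word0 : central_word v000 = 1.
Proof. by rewrite /= !mul1g. Qed.

Definition normal_word s (x : model s) : gT :=
  let: ((i, j, k), w) := x in a ^+ i * (b ^+ j * (c ^+ k * central_word w)).

Hypothesis cent_d : [/\ commute a d, commute b d & commute c d].
Hypothesis cent_e : [/\ commute a e, commute b e & commute c e].
Hypothesis cent_f : [/\ commute a f, commute b f & commute c f].
Hypotheses (d2 : d ^+ 2 = 1) (e2 : e ^+ 2 = 1) (f2 : f ^+ 2 = 1).
Hypotheses (bcd : [~ b, c] = d) (cae : [~ c, a] = e) (abf : [~ a, b] = f).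

Let central x z : x \in [:: a; b; c] -> z \in [:: d; e; f] -> commute x z.
Proof.
case: cent_d cent_e cent_f => ? ? ? [? ? ?] [? ? ?].
by rewrite !inE => /or3P[] /eqP-> /or3P[] /eqP->.
Qed.

Lemma central_word_commute x w :
  x \in [:: a; b; c] -> commute x (central_word w).
Proof.
case: w => -[p q] r abc_x.
by do ![apply: commuteM | apply: commuteX];
  apply: central; rewrite // !inE eqxx ?orbT.
Qed.

(** The hypotheses make d, e, f commute with a, b, c only; they commute with each other because e
    and f are themselves commutators of these letters. *)
Lemma central_wordM p q r p' q' r' :
  central_word (p, q, r) * central_word (p', q', r') =
    central_word (p (+) p', q (+) q', r (+) r').
Proof.
have commR x y z : x \in [:: a; b; c] -> y \in [:: a; b; c] ->
    z \in [:: d; e; f] -> commute z [~ x, y].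
  move=> xP yP zP; have zx := commute_sym (central xP zP).
  have zy := commute_sym (central yP zP).
  by do ![apply: commuteM | apply: commuteV].
have de : commute d e by rewrite -cae; apply: commR; rewrite !inE eqxx ?orbT.
have df : commute d f by rewrite -abf; apply: commR; rewrite !inE eqxx ?orbT.
have ef : commute e f by rewrite -abf; apply: commR; rewrite !inE eqxx ?orbT.
rewrite /central_word -!expg_addb // -!mulgA; congr (_ * _).
by rewrite (commuteX2A _ _ _ df) (commuteX2A _ _ _ de) (commuteX2A _ _ _ ef).
Qed.

Variable s : F2_3 * F2_3 * F2_3.
Hypothesis a2 : a ^+ 2 = central_word s.1.1.
Hypothesis b2 : b ^+ 2 = central_word s.1.2.
Hypothesis c2 : c ^+ 2 = central_word s.2.

Lemma normal_wordM : {morph @normal_word s : x y / x * y >-> x * y}.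
Proof.
have inA : a \in [:: a; b; c] by rewrite !inE eqxx.
have inB : b \in [:: a; b; c] by rewrite !inE eqxx orbT.
have inC : c \in [:: a; b; c] by rewrite !inE eqxx !orbT.
have cwA x w m z : x \in [:: a; b; c] ->
    central_word w * (x ^+ m * z) = x ^+ m * (central_word w * z).
  move=> xP; rewrite -[central_word w]expg1.
  exact/commuteX2A/central_word_commute.
(* The central word with coordinates [p, q, r] raised to the power [m], again written as a central
   word. *)
pose scale (m : bool) p q r := central_word (m && p, m && q, m && r).
have swapR x y p q r (m n : bool) z :
    x \in [:: a; b; c] -> y \in [:: a; b; c] ->
    [~ x, y] = central_word (p, q, r) ->
  y ^+ m * (x ^+ n * z) = x ^+ n * (y ^+ m * (scale (m && n) p q r * z)).
  move=> xP yP xy; rewrite expg_swapA xy.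
  - by rewrite /scale; case: (m && n); rewrite ?expg1 ?expg0 ?central_word0.
  - exact: central_word_commute.
  - exact: central_word_commute.
  by rewrite expg2 central_wordM !addbb central_word0.
have sqrR x p q r (m n : bool) z :
    x \in [:: a; b; c] -> x ^+ 2 = central_word (p, q, r) ->
  x ^+ m * (x ^+ n * z) = x ^+ (m (+) n) * (scale (m && n) p q r * z).
  rewrite /scale => xP x2; case: m n => [] []; rewrite ?central_word0 ?mul1g //.
  by rewrite mulgA -x2.
have dE : d = central_word v100 by rewrite /= !mulg1.
have eE : e = central_word v010 by rewrite /= mul1g mulg1.
have fE : f = central_word v001 by rewrite /= !mul1g.
have ba := swapR a b false false true _ _ _ inA inB (etrans abf fE).
have ac' : [~ a, c] = e by rewrite -invgR cae invg_of_expg2.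
have ca := swapR a c false true false _ _ _ inA inC (etrans ac' eE).
have cb := swapR b c true false false _ _ _ inB inC (etrans bcd dE).
case: s a2 b2 c2 => -[[[da ea] fa] [[db eb] fb]] [[dc ec] fc] a2' b2' c2'.
have aa := sqrR a da ea fa _ _ _ inA a2'.
have bb := sqrR b db eb fb _ _ _ inB b2'.
have cc := sqrR c dc ec fc _ _ _ inC c2'.
have cwa := cwA a _ _ _ inA; have cwb := cwA b _ _ _ inB.
have cwc := cwA c _ _ _ inC.
move=> x y; have -> : x * y = model_mul x y by [].
case: x y => [[[i j] k] [[p q] r]] [[[i' j'] k'] [[p' q'] r']].
rewrite /normal_word /model_mul.
(* [central_word] is generalized so that [mulgA] cannot see through it. *)
rewrite /scale in ba ca cb aa bb cc.
move: central_wordM cwa cwb cwc ba ca cb aa bb cc.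
move: central_word => cw cwM cwa cwb cwc ba ca cb aa bb cc; rewrite -!mulgA.
(* The rules push central words to the right, sort the letters into the order a, b, c and merge
   equal letters, so the rewriting ends in a normal word. *)
rewrite !(cwa, cwb, cwc, ba, ca, cb, aa, bb, cc) !cwM.
rewrite !(andbF, andbT, addbF, addFb).
(* Refolded as addition and multiplication of F_2, the exponents on the two sides can be compared by
   [ring]. *)
rewrite -![addb]/(@GRing.add _) -![andb]/(@GRing.mul _).
by congr (_ * (_ * (_ * cw (_, _, _)))); ring.
Qed.

(** One half of each identification below: a group satisfying the relations is a quotient of the
    model. The image of the normal-word morphism contains a, b, c, and it stays inside G because d,
    e, f are commutators. *)
Lemma homg_model (G : {group gT}) :
  G :=: <<[set a; b; c]>> -> G \homg [set: model s].
Proof.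
move=> defG; pose h := Morphism (D := [set: model s]) (in2W normal_wordM).
have Gabc : [/\ a \in G, b \in G & c \in G].
  by rewrite defG; split; rewrite mem_gen // !inE eqxx ?orbT.
case: Gabc => Ga Gb Gc.
apply/homgP; exists h; apply/eqP; rewrite eqEsubset; apply/andP; split.
  apply/subsetP=> _ /morphimP[[[[i j] k] [[p q] r]] _ _ ->] /=.
  rewrite -bcd -cae -abf.
  by do ![apply: groupM | apply: groupX | apply: groupR]; rewrite ?groupV.
have im (i j k : bool) : a ^+ i * (b ^+ j * c ^+ k) \in h @* setT.
  apply/morphimP; exists ((i, j, k), v000); rewrite ?inE //.
  by rewrite /= !expg0 !mulg1.
rewrite defG gen_subG; apply/subsetP=> x.
rewrite !inE => /orP[/orP[]|] /eqP->.
- by have := im true false false; rewrite expg1 !expg0 !mulg1.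
- by have := im false true false; rewrite expg1 !expg0 mulg1 mul1g.
by have := im false false true; rewrite expg1 !expg0 !mul1g.
Qed.

End ModelHom.

(** * Two-generator subgroups and A_1-subgroups in general finite groups *)

Lemma A1_group_gen2 (gT : finGroupType) (p : nat) (x y : gT) (H : {group gT}) :
    H :=: <<[set x; y]>> -> prime p -> p.-group H -> 'Phi(H) \subset 'Z(H) ->
  x * y != y * x -> A1_group H.
Proof.
(* [H / 'Phi(H)] has order at most [p ^ 2], so for a maximal subgroup [M] the
   quotient of [M] by its central subgroup ['Phi(H)] is cyclic. *)
move=> defH p_pr pH sPhiZ ncxy; split=> [|K prK].
  apply: contra ncxy => /centsP cHH; apply/eqP.
  by apply: cHH; rewrite defH mem_gen // !inE eqxx ?orbT.
have [|[M maxM sKM]] := maximal_exists (proper_sub prK).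
  by move=> defK; rewrite defK properxx in prK.
apply: abelianS sKM _.
have /andP[sMH _] := maxgroupp maxM.
have nPhiH : H \subset 'N('Phi(H)) by rewrite normal_norm ?Phi_normal.
have sPhiM : 'Phi(H) \subset M := Phi_sub_max maxM.
have sPhiZM : 'Phi(H) \subset 'Z(M).
  rewrite subsetI sPhiM (subset_trans sPhiZ) // (subset_trans _ (centS sMH)) //.
  exact: subsetIr.
apply: (cyclic_factor_abelian sPhiZM); apply: (dvdn_prime_cyclic p_pr).
have abQ := Phi_quotient_abelem pH.
have rQ : logn p #|H / 'Phi(H)| <= 2.
  rewrite -(rank_abelem abQ) -grank_abelian ?(abelem_abelian abQ) //.
  apply: leq_trans (quotient_grank nPhiH) _; rewrite defH.
  by apply: leq_trans (grank_min _) _; rewrite cards2; case: eqP.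
have oQ : #|H / 'Phi(H)| = (p * #|M / 'Phi(H)|)%N.
  rewrite !card_quotient // ?(subset_trans sMH) //.
  by rewrite -(p_maximal_index pH maxM) Lagrange_index.
rewrite -(dvdn_pmul2l (prime_gt0 p_pr)) -oQ (card_pgroup (abelem_pgroup abQ)).
by rewrite mulnn dvdn_exp2l.
Qed.

(** A cyclic quotient by the centre forces commutativity, and groups of order 1, 2 or 3 are
    cyclic. *)
Lemma center_index_ge4 (gT : finGroupType) (H : {group gT}) :
  ~~ abelian H -> 4 * #|'Z(H)| <= #|H|.
Proof.
move=> ncH; rewrite -(Lagrange (center_sub H)) mulnC leq_pmul2l ?cardG_gt0 //.
rewrite leqNgt; apply: contra ncH => lt4.
apply: cyclic_center_factor_abelian.
have: #|H / 'Z(H)| < 4 by rewrite card_quotient ?normal_norm ?center_normal.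
have := cardG_gt0 (H / 'Z(H)).
case oQ: #|H / 'Z(H)| => [|[|[|[|//]]]] // _ _.
- by rewrite (dvdn_prime_cyclic (p := 2)) // oQ.
- by rewrite (dvdn_prime_cyclic (p := 2)) // oQ.
by rewrite (dvdn_prime_cyclic (p := 3)) // oQ.
Qed.

(** The ranges suit elements of order dividing 4 whose commutator is central of order at most 2.
    That the list is the whole generated subgroup is verified by computation, through the hypothesis
    of [card_gen2]. *)
Definition words (gT : finGroupType) (x y : gT) : seq gT :=
  [seq g * [~ x, y] ^+ k
     | g <- [seq x ^+ i * y ^+ j | i <- iota 0 4, j <- iota 0 4],
       k <- iota 0 2].

Lemma words_subG (gT : finGroupType) (H : {group gT}) (x y : gT) :
  x \in H -> y \in H -> {subset words x y <= H}.
Proof.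
move=> Hx Hy _ /allpairsP[[g k] [/allpairsP[[i j] [_ _ /= ->]] _ ->]].
by rewrite groupM ?groupX ?groupR // groupM ?groupX.
Qed.

(** In a finite group every element of the generated subgroup is a product of copies of x and y,
    without inverses. Hence a list of such elements that contains 1 and is closed under right
    multiplication by x and y exhausts the subgroup. *)
Lemma card_gen2 (gT : finGroupType) (x y : gT) :
  all (fun g => (g * x \in words x y) && (g * y \in words x y)) (words x y) ->
  #|<<[set x; y]>>| = size (undup (words x y)).
Proof.
move=> /allP closed_xy; rewrite -[RHS](card_uniqP (undup_uniq _)).
apply: eq_card => g; rewrite mem_undup; apply/idP/idP => [|words_g]; last first.
  by apply: words_subG words_g; rewrite mem_gen // !inE eqxx ?orbT.
case/gen_prodgP=> n [c c_xy ->{g}]; elim: n c c_xy => [|n IHn] c c_xy.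
  by rewrite big_ord0 /words /= !expg0 !mulg1 mem_head.
rewrite big_ord_recr /=; set g := \prod_(i < n) _.
have /closed_xy/andP[] : g \in words x y by apply: IHn => i; apply: c_xy.
by have := c_xy ord_max; rewrite !inE => /orP[]/eqP->.
Qed.

Lemma A1_index_isog (gT rT : finGroupType) (G : {group gT}) (H : {group rT}) m :
  G \isog H -> A1_index G m -> A1_index H m.
Proof.
case/isogP=> h injh defH [K [sKG [ncK A1K] <-]].
exists (h @* K)%G; split; first by rewrite /= -defH morphimS.
  split=> [|L /[dup] prL /proper_sub sLhK]; first by rewrite injm_abelian.
  have sLhG : L \subset h @* G := subset_trans sLhK (morphimS _ sKG).
  rewrite -(morphpreK sLhG) injm_abelian ?subsetIl //.
  by apply: A1K; rewrite -(injm_proper injh) ?subsetIl // morphpreK.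
by rewrite -!divgS ?card_injm //= -defH ?morphimS // card_injm.
Qed.

(** * Squares, commutators and non-abelian subgroups of the model *)

Section ModelTheory.

Variable s : F2_3 * F2_3 * F2_3.

Lemma model_mulE (x y : model s) : x * y = model_mul x y. Proof. by []. Qed.
Lemma model_invE (x : model s) : x^-1 = model_inv x. Proof. by []. Qed.

Lemma model_central w (y : model s) : commute ((v000, w) : model s) y.
Proof.
rewrite /commute !model_mulE; case: w y => [[p q] r] [[[i j] k] [[p' q'] r']].
rewrite /model_mul /model; case: s => -[[[da ea] fa] [[db eb] fb]] [[dc ec] fc].
rewrite -[false]/(@GRing.zero bool).
by congr ((_, _, _), (_, _, _)); ring.
Qed.

Lemma model_sqr (x : model s) : x ^+ 2 = (v000, (x ^+ 2).2).
Proof.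
rewrite expg2 model_mulE; case: x => [[[i j] k] [[p q] r]].
rewrite /model_mul /model; case: s => -[[[da ea] fa] [[db eb] fb]] [[dc ec] fc].
by rewrite -![(_ + _)%R in X in (X, _) = _]/(_ (+) _) !addbb.
Qed.

Lemma model_comm (x y : model s) : [~ x, y] = (v000, [~ x, y].2).
Proof.
rewrite commgEl conjgE !model_mulE !model_invE.
case: x y => [[[i j] k] [[p q] r]] [[[i' j'] k'] [[p' q'] r']].
rewrite /model_mul /model_inv /model.
case: s => -[[[da ea] fa] [[db eb] fb]] [[dc ec] fc].
congr (_, _); rewrite -[false]/(@GRing.zero bool).
by congr (_, _, _); ring.
Qed.

Lemma model_vec_mul v w :
  ((v, w) : model s) = ((v, v000) : model s) * ((v000, w) : model s).
Proof.
rewrite model_mulE; case: v w => [[i j] k] [[p q] r]; rewrite /model_mul /model.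
case: s => -[[[da ea] fa] [[db eb] fb]] [[dc ec] fc].
rewrite -[false]/(@GRing.zero bool).
by congr ((_, _, _), (_, _, _)); ring.
Qed.

Lemma model_central_sqr w : ((v000, w) : model s) ^+ 2 = 1.
Proof.
rewrite expg2 model_mulE; case: w => [[p q] r]; rewrite /model_mul /model.
case: s => -[[[da ea] fa] [[db eb] fb]] [[dc ec] fc].
by case: p q r => [] [] [].
Qed.

(** The factor (0, w) is central with trivial square, so it disappears on squaring. *)
Lemma model_sqr_vec v w : ((v, w) : model s) ^+ 2 = ((v, v000) : model s) ^+ 2.
Proof.
rewrite model_vec_mul expgMn; last exact/commute_sym/model_central.
by rewrite model_central_sqr mulg1.
Qed.

Lemma model_comm_vec v w v' w' :
  [~ (v, w) : model s, (v', w')] = [~ (v, v000) : model s, (v', v000)].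
Proof.
rewrite model_vec_mul [X in [~ _, X]]model_vec_mul.
set x := ((v, v000) : model s); set y := ((v', v000) : model s).
have cen w0 z : z ^ ((v000, w0) : model s) = z.
  by rewrite conjgE -model_central mulKg.
have cen1 w0 z : [~ (v000, w0) : model s, z] = 1.
  exact/eqP/commgP/model_central.
have cen1' w0 z : [~ z, (v000, w0) : model s] = 1 by rewrite -invgR cen1 invg1.
by rewrite commMgJ cen1 mulg1 cen commgMJ cen1' mul1g cen.
Qed.

Lemma card_model : #|[set: model s]| = 64.
Proof. by rewrite cardsT !card_prod card_bool. Qed.

Lemma model_center_mem (H : {group model s}) (x : model s) :
  x \in H -> x.1 = v000 -> x \in 'Z(H).
Proof.
case: x => v w /[swap] /= -> Hx; rewrite inE Hx; apply/centP=> y _.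
exact: model_central.
Qed.

(** The Frattini subgroup of a 2-group is generated by commutators and squares; in the model both
    have trivial image in F_2^3, hence are central. *)
Lemma model_Phi_center (H : {group model s}) : 'Phi(H) \subset 'Z(H).
Proof.
have pH : 2.-group H.
  by apply: pgroupS (subsetT H) _; rewrite /pgroup card_model.
have zH := @model_center_mem H.
rewrite (Phi_joing pH) join_subG (MhoE 1 pH) !gen_subG.
apply/andP; split; apply/subsetP=> z.
  case/imset2P=> x y Hx Hy ->; apply: zH; first exact: groupR.
  by rewrite model_comm.
by case/imsetP=> x Hx ->; apply: zH; rewrite ?groupX // expn1 model_sqr.
Qed.

(** In the model x^2, y^2 and [x, y] lie in a central subgroup of exponent 2, so exponents below 2
    list all of the subgroup that they generate. *)
Definition squares (gT : finGroupType) (x y : gT) : seq gT :=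
  [seq g * [~ x, y] ^+ k
     | g <- [seq (x ^+ 2) ^+ i * (y ^+ 2) ^+ j | i <- iota 0 2, j <- iota 0 2],
       k <- iota 0 2].

Lemma squares_center (H : {group model s}) (x y : model s) :
  x \in H -> y \in H -> {subset squares x y <= 'Z(H)}.
Proof.
move=> Hx Hy _ /allpairsP[[g k] [/allpairsP[[i j] [_ _ /= ->]] _ ->]].
have Zx2 : x ^+ 2 \in 'Z(H).
  by rewrite model_center_mem ?groupX // model_sqr.
have Zy2 : y ^+ 2 \in 'Z(H).
  by rewrite model_center_mem ?groupX // model_sqr.
have Zxy : [~ x, y] \in 'Z(H).
  by rewrite model_center_mem ?groupR // model_comm.
by apply: groupM; [apply: groupM|]; apply: groupX.
Qed.

(** An explicit list, so that [nonabelian_order_ge] can be evaluated by [vm_compute]. *)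
Definition F2_3_enum : seq F2_3 :=
  let bools := [:: false; true] in
  [seq (ij, k) | ij <- [seq (i, j) | i <- bools, j <- bools], k <- bools].

Definition nonabelian_order_ge n : bool :=
  all2rel (fun v v' =>
    let x : model s := (v, v000) in let y : model s := (v', v000) in
    (x * y == y * x) || (n <= 4 * size (undup (squares x y)))%N) F2_3_enum.

(** For non-commuting x, y in H, |H| is at least 4 |Z(H)| and Z(H) contains [squares x y]. Replacing
    x and y by the representatives with central part 0 changes neither the squares nor the
    commutator, which leaves finitely many explicit pairs to check. *)
Lemma nonabelian_order_geP n (H : {group model s}) :
  nonabelian_order_ge n -> ~~ abelian H -> n <= #|H|.
Proof.
move=> /allrelP ge_n ncH.
have /existsP[x /existsP[y /and3P[Hx Hy ncxy]]] :
    [exists x, exists y, [&& x \in H, y \in H & x * y != y * x]].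
  apply: contraR ncH => /existsPn noncom; apply/centsP=> x Hx y Hy.
  by have /existsPn/(_ y) := noncom x; rewrite Hx Hy negbK => /eqP.
apply: leq_trans (center_index_ge4 ncH).
have enumP v : v \in F2_3_enum by case: v => [[[] []] []].
pose x0 : model s := (x.1, v000); pose y0 : model s := (y.1, v000).
have : (x0 * y0 == y0 * x0) || (n <= 4 * size (undup (squares x0 y0)))%N.
  exact: ge_n (enumP _) (enumP _).
(* Commutation is expressed through the commutator, which depends only on the images in F_2^3. *)
have comE (u v : model s) : (u * v == v * u) = ([~ u, v] == 1).
  exact: (sameP eqP commgP).
rewrite comE -(model_comm_vec _ x.2 _ y.2) -comE.
have -> : squares x0 y0 = squares x y.
  rewrite /squares -(model_sqr_vec _ x.2) -(model_sqr_vec _ y.2).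
  by rewrite -(model_comm_vec _ x.2 _ y.2) -!surjective_pairing.
rewrite -!surjective_pairing (negPf ncxy) => /leq_trans-> //.
rewrite leq_pmul2l // -(card_uniqP (undup_uniq _)).
apply/subset_leq_card/subsetP=> z; rewrite mem_undup.
exact: squares_center.
Qed.

Definition A1_witness (x y : model s) (m : nat) :=
  [&& x * y != y * x,
      all (fun g => (g * x \in words x y) && (g * y \in words x y)) (words x y)
    & (m * size (undup (words x y)) == 64)%N].

(** Minimality comes from [A1_group_gen2], applicable because the Frattini subgroup is central; the
    index comes from the count of words. *)
Lemma A1_witnessP x y m : A1_witness x y m -> A1_index [set: model s] m.
Proof.
case/and3P=> ncxy /card_gen2 oH /eqP om.
have pH : 2.-group <<[set x; y]>>.
  by apply: pgroupS (subsetT _) _; rewrite /pgroup card_model.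
exists <<[set x; y]>>%G; split; first exact: subsetT.
  exact: A1_group_gen2 (erefl _) (isT : prime 2) pH (model_Phi_center _) ncxy.
by rewrite -divgS ?subsetT //= oH card_model -om mulnK // -oH cardG_gt0.
Qed.

Lemma A1_index_bound n m :
  nonabelian_order_ge n -> A1_index [set: model s] m -> (m * n <= 64)%N.
Proof.
move=> ge_n [H [sHG [ncH _] <-]].
rewrite -card_model -(Lagrange sHG) mulnC leq_mul2r.
by rewrite (nonabelian_order_geP ge_n) // orbT.
Qed.

End ModelTheory.

(** * Generators of the model and tools for presentations *)

Definition gen_a s : model s := (v100, v000).
Definition gen_b s : model s := (v010, v000).
Definition gen_c s : model s := (v001, v000).
Definition gen_d s : model s := (v000, v100).
Definition gen_e s : model s := (v000, v010).
Definition gen_f s : model s := (v000, v001).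

Lemma gen_swap s :
  [/\ gen_c s * gen_b s = gen_b s * gen_c s * gen_d s,
      gen_c s * gen_a s = gen_a s * gen_c s * gen_e s
    & gen_b s * gen_a s = gen_a s * gen_b s * gen_f s].
Proof. by case: s => -[[[? ?] ?] [[? ?] ?]] [[? ?] ?]. Qed.

Lemma gen_word s (x : model s) :
  x = gen_a s ^+ x.1.1.1 * gen_b s ^+ x.1.1.2 * gen_c s ^+ x.1.2 *
      (gen_d s ^+ x.2.1.1 * gen_e s ^+ x.2.1.2 * gen_f s ^+ x.2.2).
Proof.
case: x => [[[i j] k] [[p q] r]].
case: s => [[[[? ?] ?] [[? ?] ?]] [[? ?] ?]].
by case: i j k p q r => [] [] [] [] [] [].
Qed.

(** The swap relations recover d, e, f as commutators of a, b, c, and normal words then give every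
    element. *)
Lemma model_gen s (K : {group model s}) :
  gen_a s \in K -> gen_b s \in K -> gen_c s \in K -> K :=: setT.
Proof.
move=> Ka Kb Kc; apply/setP=> x; rewrite inE.
have swap (y z t : model s) :
    y \in K -> z \in K -> z * y = y * z * t -> t \in K.
  by move=> Ky Kz yz; rewrite -(mulKg (y * z) t) -yz !groupM ?groupV ?groupM.
have [cb ca ba] := gen_swap s.
have Kd := swap _ _ _ Kb Kc cb; have Ke := swap _ _ _ Ka Kc ca.
have Kf := swap _ _ _ Ka Kb ba.
by rewrite (gen_word x); do ![apply: groupM | apply: groupX].
Qed.

(** Conjugation by y sends x to x [x, y], whose square is x^2 [x, y]^2 = x^2. This yields the
    centrality of squares that a presentation does not state. *)
Lemma sqr_commute (gT : finGroupType) (x y : gT) :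
  commute x [~ x, y] -> [~ x, y] ^+ 2 = 1 -> commute y (x ^+ 2).
Proof.
have: x * y = y * x * [~ x, y] by rewrite -commgC.
move: [~ x, y] => t xy cxt t2; apply/commute_sym; rewrite /commute expg2.
rewrite -mulgA xy !mulgA xy -!mulgA; congr (_ * (_ * _)).
by rewrite mulgA -cxt -mulgA -expg2 t2 mulg1.
Qed.

Lemma sqr_commuter (gT : finGroupType) (x y : gT) :
  commute y [~ x, y] -> [~ x, y] ^+ 2 = 1 -> commute x (y ^+ 2).
Proof.
rewrite -invgR => cyt t2; apply: sqr_commute.
  by rewrite -[[~ y, x]]invgK; apply: commuteV.
by rewrite -[LHS]invgK -expgVn t2 invg1.
Qed.

Lemma commute_of_commg (gT : finGroupType) (x y : gT) :
  [~ x, y] = 1 -> commute y x.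
Proof. by move/eqP/commgP/commute_sym. Qed.

(** [Grp] describes the generated group as a join of cyclic groups. This lemma and the next reduce
    that join to the subgroup generated by a, b, c, absorbing d, e, f. *)
Lemma joing_cycles3 (gT : finGroupType) (x y z : gT) :
  <[x]> <*> <[y]> <*> <[z]> = <<[set x; y; z]>>.
Proof. by rewrite /cycle !(joing_idl, joing_idr). Qed.

Lemma joing_cycle_id (gT : finGroupType) (A : {set gT}) (x : gT) :
  x \in <<A>> -> <<A>> <*> <[x]> = <<A>>.
Proof. by move=> Ax; apply/joing_idPl; rewrite cycle_subG. Qed.

Lemma gen_model s : <<[set gen_a s; gen_b s; gen_c s]>> = setT.
Proof. by apply: model_gen; rewrite mem_gen // !inE eqxx ?orbT. Qed.

(** The triples are obtained by solving the relations for the squares. In (S10), for instance, f =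
    c^2, e = b^2 c^2 and d = a^2 b^2 give c^2 = f, b^2 = e f and a^2 = d e f. *)
Definition sq1 : F2_3 * F2_3 * F2_3 := (v000, v000, v000).
Definition sq2 : F2_3 * F2_3 * F2_3 := (v000, v000, v001).
Definition sq3 : F2_3 * F2_3 * F2_3 := (v011, v001, v000).
Definition sq4 : F2_3 * F2_3 * F2_3 := (v001, v011, v000).
Definition sq5 : F2_3 * F2_3 * F2_3 := (v001, v001, v000).
Definition sq6 : F2_3 * F2_3 * F2_3 := (v001, v001, v001).
Definition sq7 : F2_3 * F2_3 * F2_3 := (v010, v000, v001).
Definition sq8 : F2_3 * F2_3 * F2_3 := (v010, v001, v001).
Definition sq9 : F2_3 * F2_3 * F2_3 := (v001, v011, v001).
Definition sq10 : F2_3 * F2_3 * F2_3 := (v111, v011, v001).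

(** * Identification of the ten presented groups with models *)

Lemma mem_gen3 (gT : finGroupType) (x y z : gT) (K := <<[set x; y; z]>>) :
  [/\ [~ y, z] \in K, [~ z, x] \in K & [~ x, y] \in K].
Proof.
have [Kx Ky Kz] : [/\ x \in K, y \in K & z \in K].
  by split; rewrite mem_gen // !inE eqxx ?orbT.
by split; apply: groupR.
Qed.

Lemma expg4_eq1 (gT : finGroupType) (x : gT) : x ^+ 4 = 1 -> x ^+ 2 ^+ 2 = 1.
Proof. by rewrite -expgM. Qed.

Lemma sqr_eq1M (gT : finGroupType) (x y : gT) :
  commute x y -> x ^+ 2 = 1 -> y ^+ 2 = 1 -> (x * y) ^+ 2 = 1.
Proof. by move=> cxy x2 y2; rewrite expgMn // x2 y2 mulg1. Qed.

Lemma commute_sqr (gT : finGroupType) (x : gT) : commute x (x ^+ 2).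
Proof. exact/commuteX/commute_refl. Qed.

(** Pattern of all ten proofs: the model satisfies the relations, so it is a quotient of G;
    conversely [homg_model] makes G a quotient of the model. For finite groups this gives an
    isomorphism. *)
Lemma S1_isog (gT : finGroupType) (G : {group gT}) :
  S1 G -> [set: model sq1] \isog G.
Proof.
move=> isoG; rewrite isogEhom; apply/andP; split.
  rewrite isoG; apply/existsP; exists
    (gen_a _, gen_b _, gen_c _, gen_d _, gen_e _, gen_f _).
  (* [Grp] packs generation and relations into one equation of tuples. Generation is settled first;
     the relations then hold by computation in the model. *)
  apply/eqP; rewrite [X in (X, _) = _](_ : _ = setT); last first.
    by rewrite joing_cycles3 !joing_cycle_id ?gen_model ?inE.
  by congr (_, _).
have /existsP[[[[[[a b] c] d] e] f] /eqP[]] := isoGrp_hom isoG.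
move=> defG a2 b2 c2 d2 e2 f2 bcd cae abf da db dc ea eb ec fa fb fc.
have sqC := @commute_sqr gT.
have cd : [/\ commute a d, commute b d & commute c d].
  by split; apply: commute_of_commg.
have ce : [/\ commute a e, commute b e & commute c e].
  by split; apply: commute_of_commg.
have cf : [/\ commute a f, commute b f & commute c f].
  by split; apply: commute_of_commg.
apply: (@homg_model _ a b c d e f) => //=;
  rewrite ?(expg0, expg1, mul1g, mulg1) //.
have [dK eK fK] := mem_gen3 a b c.
rewrite bcd in dK; rewrite cae in eK; rewrite abf in fK.
by rewrite -defG joing_cycles3 !joing_cycle_id.
Qed.

Lemma S2_isog (gT : finGroupType) (G : {group gT}) :
  S2 G -> [set: model sq2] \isog G.
Proof.
move=> isoG; rewrite isogEhom; apply/andP; split.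
  rewrite isoG; apply/existsP; exists
    (gen_a _, gen_b _, gen_c _, gen_d _, gen_e _).
  apply/eqP; rewrite [X in (X, _) = _](_ : _ = setT); last first.
    by rewrite joing_cycles3 !joing_cycle_id ?gen_model ?inE.
  by congr (_, _).
have /existsP[[[[[a b] c] d] e] /eqP[]] := isoGrp_hom isoG.
move=> defG a2 b2 c4 d2 e2 bcd cae abf da db dc ea eb ec.
have sqC := @commute_sqr gT.
have c22 := expg4_eq1 c4.
have cd : [/\ commute a d, commute b d & commute c d].
  by split; apply: commute_of_commg.
have ce : [/\ commute a e, commute b e & commute c e].
  by split; apply: commute_of_commg.
(* Here f = c^2; it is central because [c, a] = e and [b, c] = d are central of order at most 2. *)
have cf : [/\ commute a (c ^+ 2), commute b (c ^+ 2) & commute c (c ^+ 2)].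
  split; last exact: commute_sqr.
    by apply: sqr_commute; rewrite cae //; case: ce.
  by apply: sqr_commuter; rewrite bcd //; case: cd.
apply: (@homg_model _ a b c d e (c ^+ 2)) => //=;
  rewrite ?(expg0, expg1, mul1g, mulg1) //.
have [dK eK fK] := mem_gen3 a b c.
rewrite bcd in dK; rewrite cae in eK.
by rewrite -defG joing_cycles3 !joing_cycle_id.
Qed.

Lemma S3_isog (gT : finGroupType) (G : {group gT}) :
  S3 G -> [set: model sq3] \isog G.
Proof.
move=> isoG; rewrite isogEhom; apply/andP; split.
  rewrite isoG; apply/existsP; exists
    (gen_a _, gen_b _, gen_c _, gen_d _).
  apply/eqP; rewrite [X in (X, _) = _](_ : _ = setT); last first.
    by rewrite joing_cycles3 !joing_cycle_id ?gen_model ?inE.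
  by congr (_, _).
have /existsP[[[[a b] c] d] /eqP[]] := isoGrp_hom isoG.
move=> defG a4 b4 c2 d2 bcd cae abf da db dc.
have sqC := @commute_sqr gT.
have a22 := expg4_eq1 a4.
have b22 := expg4_eq1 b4.
have cd : [/\ commute a d, commute b d & commute c d].
  by split; apply: commute_of_commg.
(* The order of deduction matters: [a, b] = b^2 commutes with b, so b^2 commutes with a, and then
   a^2 with b. Next d gives that b^2 commutes with c; finally e = a^2 b^2 commutes with a, so a^2
   commutes with c. *)
have cab2 : commute a (b ^+ 2).
  by apply: sqr_commuter; rewrite abf //; apply: commute_sqr.
have cba2 : commute b (a ^+ 2) by apply: sqr_commute; rewrite abf.
have ccb2 : commute c (b ^+ 2) by apply: sqr_commute; rewrite bcd //; case: cd.
have e2 : (a ^+ 2 * b ^+ 2) ^+ 2 = 1.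
  by apply: sqr_eq1M => //; exact/commuteX/commute_sym.
have cae2 : commute a (a ^+ 2 * b ^+ 2) by apply: commuteM.
have cca2 : commute c (a ^+ 2) by apply: sqr_commuter; rewrite cae.
apply: (@homg_model _ a b c d (a ^+ 2 * b ^+ 2) (b ^+ 2)) => //=;
  rewrite ?(expg0, expg1, mul1g, mulg1) //.
- by split=> //; apply: commuteM.
(* This is a^2 = e f, that is a^2 = (a^2 b^2) b^2. *)
- by rewrite -mulgA -expg2 b22 mulg1.
have [dK eK fK] := mem_gen3 a b c.
rewrite bcd in dK.
by rewrite -defG joing_cycles3 !joing_cycle_id.
Qed.

Lemma S4_isog (gT : finGroupType) (G : {group gT}) :
  S4 G -> [set: model sq4] \isog G.
Proof.
move=> isoG; rewrite isogEhom; apply/andP; split.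
  rewrite isoG; apply/existsP; exists
    (gen_a _, gen_b _, gen_c _, gen_d _).
  apply/eqP; rewrite [X in (X, _) = _](_ : _ = setT); last first.
    by rewrite joing_cycles3 !joing_cycle_id ?gen_model ?inE.
  by congr (_, _).
have /existsP[[[[a b] c] d] /eqP[]] := isoGrp_hom isoG.
move=> defG a4 b4 c2 d2 bcd cae abf da db dc.
have sqC := @commute_sqr gT.
have a22 := expg4_eq1 a4.
have b22 := expg4_eq1 b4.
have cd : [/\ commute a d, commute b d & commute c d].
  by split; apply: commute_of_commg.
(* Now [a, b] = a^2 commutes with a, so the chain used for (S3) starts with a^2 and b instead of b^2
   and a. *)
have cba2 : commute b (a ^+ 2).
  by apply: sqr_commute; rewrite abf //; apply: commute_sqr.
have cab2 : commute a (b ^+ 2) by apply: sqr_commuter; rewrite abf.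
have ccb2 : commute c (b ^+ 2) by apply: sqr_commute; rewrite bcd //; case: cd.
have e2 : (a ^+ 2 * b ^+ 2) ^+ 2 = 1.
  by apply: sqr_eq1M => //; exact/commuteX/commute_sym.
have cae2 : commute a (a ^+ 2 * b ^+ 2) by apply: commuteM.
have cca2 : commute c (a ^+ 2) by apply: sqr_commuter; rewrite cae.
apply: (@homg_model _ a b c d (a ^+ 2 * b ^+ 2) (a ^+ 2)) => //=;
  rewrite ?(expg0, expg1, mul1g, mulg1) //.
- by split=> //; apply: commuteM.
- by rewrite (commuteX 2 (commute_sym cba2)) -mulgA -expg2 a22 mulg1.
have [dK eK fK] := mem_gen3 a b c.
rewrite bcd in dK.
by rewrite -defG joing_cycles3 !joing_cycle_id.
Qed.

Lemma S5_isog (gT : finGroupType) (G : {group gT}) :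
  S5 G -> [set: model sq5] \isog G.
Proof.
move=> isoG; rewrite isogEhom; apply/andP; split.
  rewrite isoG; apply/existsP; exists
    (gen_a _, gen_b _, gen_c _, gen_d _, gen_e _).
  apply/eqP; rewrite [X in (X, _) = _](_ : _ = setT); last first.
    by rewrite joing_cycles3 !joing_cycle_id ?gen_model ?inE.
  by congr (_, _).
have /existsP[[[[[a b] c] d] e] /eqP[]] := isoGrp_hom isoG.
move=> defG a4 b4 c2 d2 e2 bcd cae abf ab da db dc ea eb ec.
have sqC := @commute_sqr gT.
have a22 := expg4_eq1 a4.
have cd : [/\ commute a d, commute b d & commute c d].
  by split; apply: commute_of_commg.
have ce : [/\ commute a e, commute b e & commute c e].
  by split; apply: commute_of_commg.
have cba2 : commute b (a ^+ 2) by rewrite ab; apply: commute_sqr.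
have cca2 : commute c (a ^+ 2).
  by rewrite ab; apply: sqr_commute; rewrite bcd //; case: cd.
apply: (@homg_model _ a b c d e (a ^+ 2)) => //=;
  rewrite ?(expg0, expg1, mul1g, mulg1) //.
have [dK eK fK] := mem_gen3 a b c.
rewrite bcd in dK; rewrite cae in eK.
by rewrite -defG joing_cycles3 !joing_cycle_id.
Qed.

Lemma S6_isog (gT : finGroupType) (G : {group gT}) :
  S6 G -> [set: model sq6] \isog G.
Proof.
move=> isoG; rewrite isogEhom; apply/andP; split.
  rewrite isoG; apply/existsP; exists
    (gen_a _, gen_b _, gen_c _, gen_d _, gen_e _).
  apply/eqP; rewrite [X in (X, _) = _](_ : _ = setT); last first.
    by rewrite joing_cycles3 !joing_cycle_id ?gen_model ?inE.
  by congr (_, _).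
have /existsP[[[[[a b] c] d] e] /eqP[]] := isoGrp_hom isoG.
move=> defG a4 b4 c4 d2 e2 bcd cae abf ab bc da db dc ea eb ec.
have sqC := @commute_sqr gT.
have a22 := expg4_eq1 a4.
have cd : [/\ commute a d, commute b d & commute c d].
  by split; apply: commute_of_commg.
have ce : [/\ commute a e, commute b e & commute c e].
  by split; apply: commute_of_commg.
have cba2 : commute b (a ^+ 2) by rewrite ab; apply: commute_sqr.
have cca2 : commute c (a ^+ 2) by rewrite ab bc; apply: commute_sqr.
apply: (@homg_model _ a b c d e (a ^+ 2)) => //=;
  rewrite ?(expg0, expg1, mul1g, mulg1) //.
- by rewrite ab bc.
have [dK eK fK] := mem_gen3 a b c.
rewrite bcd in dK; rewrite cae in eK.
by rewrite -defG joing_cycles3 !joing_cycle_id.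
Qed.

Lemma S7_isog (gT : finGroupType) (G : {group gT}) :
  S7 G -> [set: model sq7] \isog G.
Proof.
move=> isoG; rewrite isogEhom; apply/andP; split.
  rewrite isoG; apply/existsP; exists
    (gen_a _, gen_b _, gen_c _, gen_d _).
  apply/eqP; rewrite [X in (X, _) = _](_ : _ = setT); last first.
    by rewrite joing_cycles3 !joing_cycle_id ?gen_model ?inE.
  by congr (_, _).
have /existsP[[[[a b] c] d] /eqP[]] := isoGrp_hom isoG.
move=> defG a4 b2 c4 d2 bcd cae abf da db dc.
have sqC := @commute_sqr gT.
have a22 := expg4_eq1 a4.
have c22 := expg4_eq1 c4.
have cd : [/\ commute a d, commute b d & commute c d].
  by split; apply: commute_of_commg.
(* The relation [c, a] = a^2 starts the chain: a^2 commutes with c, then c^2 with a, and then [a, b]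
   = c^2 makes a^2 commute with b. *)
have cca2 : commute c (a ^+ 2).
  by apply: sqr_commuter; rewrite cae //; apply: commute_sqr.
have cac2 : commute a (c ^+ 2) by apply: sqr_commute; rewrite cae.
have cba2 : commute b (a ^+ 2) by apply: sqr_commute; rewrite abf.
have cbc2 : commute b (c ^+ 2) by apply: sqr_commuter; rewrite bcd //; case: cd.
apply: (@homg_model _ a b c d (a ^+ 2) (c ^+ 2)) => //=;
  rewrite ?(expg0, expg1, mul1g, mulg1) //.
have [dK eK fK] := mem_gen3 a b c.
rewrite bcd in dK.
by rewrite -defG joing_cycles3 !joing_cycle_id.
Qed.

Lemma S8_isog (gT : finGroupType) (G : {group gT}) :
  S8 G -> [set: model sq8] \isog G.
Proof.
move=> isoG; rewrite isogEhom; apply/andP; split.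
  rewrite isoG; apply/existsP; exists
    (gen_a _, gen_b _, gen_c _, gen_d _).
  apply/eqP; rewrite [X in (X, _) = _](_ : _ = setT); last first.
    by rewrite joing_cycles3 !joing_cycle_id ?gen_model ?inE.
  by congr (_, _).
have /existsP[[[[a b] c] d] /eqP[]] := isoGrp_hom isoG.
move=> defG a4 b4 c4 d2 bcd cae abf bc da db dc.
have sqC := @commute_sqr gT.
have a22 := expg4_eq1 a4.
have b22 := expg4_eq1 b4.
have cd : [/\ commute a d, commute b d & commute c d].
  by split; apply: commute_of_commg.
have cca2 : commute c (a ^+ 2).
  by apply: sqr_commuter; rewrite cae //; apply: commute_sqr.
have cab2 : commute a (b ^+ 2).
  by apply: sqr_commuter; rewrite abf //; apply: commute_sqr.
have cba2 : commute b (a ^+ 2) by apply: sqr_commute; rewrite abf.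
have ccb2 : commute c (b ^+ 2) by rewrite bc; apply: commute_sqr.
apply: (@homg_model _ a b c d (a ^+ 2) (b ^+ 2)) => //=;
  rewrite ?(expg0, expg1, mul1g, mulg1) //.
have [dK eK fK] := mem_gen3 a b c.
rewrite bcd in dK.
by rewrite -defG joing_cycles3 !joing_cycle_id.
Qed.

Lemma S9_isog (gT : finGroupType) (G : {group gT}) :
  S9 G -> [set: model sq9] \isog G.
Proof.
move=> isoG; rewrite isogEhom; apply/andP; split.
  rewrite isoG; apply/existsP; exists
    (gen_a _, gen_b _, gen_c _, gen_d _).
  apply/eqP; rewrite [X in (X, _) = _](_ : _ = setT); last first.
    by rewrite joing_cycles3 !joing_cycle_id ?gen_model ?inE.
  by congr (_, _).
have /existsP[[[[a b] c] d] /eqP[]] := isoGrp_hom isoG.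
move=> defG a4 b4 c4 d2 bcd cae abf ac da db dc.
have sqC := @commute_sqr gT.
have a22 := expg4_eq1 a4.
have b22 := expg4_eq1 b4.
have cd : [/\ commute a d, commute b d & commute c d].
  by split; apply: commute_of_commg.
have cba2 : commute b (a ^+ 2).
  by apply: sqr_commute; rewrite abf //; apply: commute_sqr.
have cab2 : commute a (b ^+ 2) by apply: sqr_commuter; rewrite abf.
have ccb2 : commute c (b ^+ 2) by apply: sqr_commute; rewrite bcd //; case: cd.
have cca2 : commute c (a ^+ 2) by rewrite ac; apply: commute_sqr.
have e2 : (a ^+ 2 * b ^+ 2) ^+ 2 = 1.
  by apply: sqr_eq1M => //; exact/commuteX/commute_sym.
apply: (@homg_model _ a b c d (a ^+ 2 * b ^+ 2) (a ^+ 2)) => //=;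
  rewrite ?(expg0, expg1, mul1g, mulg1) //.
- by split=> //; apply: commuteM.
- by rewrite (commuteX 2 (commute_sym cba2)) -mulgA -expg2 a22 mulg1.
have [dK eK fK] := mem_gen3 a b c.
rewrite bcd in dK.
by rewrite -defG joing_cycles3 !joing_cycle_id.
Qed.

Lemma S10_isog (gT : finGroupType) (G : {group gT}) :
  S10 G -> [set: model sq10] \isog G.
Proof.
move=> isoG; rewrite isogEhom; apply/andP; split.
  rewrite isoG; apply/existsP; exists
    (gen_a _, gen_b _, gen_c _).
  apply/eqP; rewrite [X in (X, _) = _](_ : _ = setT); last first.
    by rewrite joing_cycles3 ?gen_model ?inE.
  by congr (_, _).
have /existsP[[[a b] c] /eqP[]] := isoGrp_hom isoG.
move=> defG a4 b4 c4 bcd cae abf c2a c2b.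
have sqC := @commute_sqr gT.
have a22 := expg4_eq1 a4.
have b22 := expg4_eq1 b4.
have c22 := expg4_eq1 c4.
(* Only the centrality of c^2 is a relation. From [a, b] = c^2 it follows that a^2 and b^2 commute
   with a and b; hence d = a^2 b^2 commutes with b, so b^2 commutes with c, and e = b^2 c^2 commutes
   with a, so a^2 commutes with c. *)
have cac2 : commute a (c ^+ 2) by apply: commute_of_commg.
have cbc2 : commute b (c ^+ 2) by apply: commute_of_commg.
have cba2 : commute b (a ^+ 2) by apply: sqr_commute; rewrite abf.
have cab2 : commute a (b ^+ 2) by apply: sqr_commuter; rewrite abf.
have d2 : (a ^+ 2 * b ^+ 2) ^+ 2 = 1.
  by apply: sqr_eq1M => //; exact/commuteX/commute_sym.
have cbd : commute b (a ^+ 2 * b ^+ 2) by apply: commuteM.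
have cae' : commute a (b ^+ 2 * c ^+ 2) by apply: commuteM.
have ccb2 : commute c (b ^+ 2) by apply: sqr_commute; rewrite bcd.
have e2 : (b ^+ 2 * c ^+ 2) ^+ 2 = 1.
  by apply: sqr_eq1M => //; exact/commuteX/commute_sym.
have cca2 : commute c (a ^+ 2) by apply: sqr_commuter; rewrite cae.
apply: (@homg_model _ a b c (a ^+ 2 * b ^+ 2) (b ^+ 2 * c ^+ 2) (c ^+ 2))
  => //=;
  rewrite ?(expg0, expg1, mul1g, mulg1) //.
- by split=> //; apply: commuteM.
- by split=> //; apply: commuteM.
- by rewrite -(mulgA (b ^+ 2)) -expg2 c22 mulg1 -mulgA -expg2 b22 mulg1.
- by rewrite -mulgA -expg2 c22 mulg1.
by rewrite -defG joing_cycles3.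
Qed.

(** * Indices of A_1-subgroups in the ten groups *)

Lemma is_Imin1 (gT : finGroupType) (G : {group gT}) :
  A1_index G 2 -> is_Imin G 1.
Proof.
move=> A1_2; split=> // m [H [sHG [_ A1H] <-]].
case: A1_2 => K [sKG [ncK _] iK].
(* Index 1 would make G itself an A_1-group, and its proper subgroup K would be abelian. *)
rewrite expn1 ltn_neqAle eq_sym indexg_eq1 indexg_gt0 andbT.
apply: contra ncK => sGH; apply: A1H; rewrite properE (subset_trans sKG sGH) /=.
apply/negP=> sHK; have := subset_trans sGH sHK.
by rewrite -indexg_eq1 iK.
Qed.

Section FromModel.

Variables (gT : finGroupType) (G : {group gT}) (s : F2_3 * F2_3 * F2_3).
Hypothesis isoG : [set: model s] \isog G.

Lemma A1_index_witness (x y : model s) m : A1_witness x y m -> A1_index G m.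
Proof. by move/A1_witnessP; apply: A1_index_isog. Qed.

Lemma A1_index_le n m :
  nonabelian_order_ge s n -> A1_index G m -> (m * n <= 64)%N.
Proof.
move=> ge_n A1m; apply: (A1_index_bound ge_n).
by apply: A1_index_isog A1m; rewrite isog_sym.
Qed.

(** For the theorem it suffices to exclude the wrong values of I_max; here index 8 exceeds both 2^2
    and 2^1. *)
Lemma Imax_ne12 (x y x' y' : model s) :
    A1_witness x y 2 -> A1_witness x' y' 8 ->
  [/\ is_Imin G 1, ~ is_Imax G 2 & ~ is_Imax G 1].
Proof.
move=> /A1_index_witness/is_Imin1 ? /A1_index_witness A1_8.
by split=> // -[_ /(_ _ A1_8)].
Qed.

(** Index 4 exceeds 2^1, and index 8 is impossible because 8 * 16 > 64. *)
Lemma Imax_ne13 (x y x' y' : model s) :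
    A1_witness x y 2 -> A1_witness x' y' 4 -> nonabelian_order_ge s 16 ->
  [/\ is_Imin G 1, ~ is_Imax G 3 & ~ is_Imax G 1].
Proof.
move=> /A1_index_witness/is_Imin1 ? /A1_index_witness A1_4 ge16.
by split=> // [[/(A1_index_le ge16)] | [_ /(_ _ A1_4)]].
Qed.

Lemma Imax_ne23 (x y : model s) :
    A1_witness x y 2 -> nonabelian_order_ge s 32 ->
  [/\ is_Imin G 1, ~ is_Imax G 3 & ~ is_Imax G 2].
Proof.
move=> /A1_index_witness/is_Imin1 ? ge32.
by split=> // -[/(A1_index_le ge32)].
Qed.

End FromModel.

(** For x, y with independent images in F_2^3 the index of the generated subgroup is 16 divided by
    |<x^2, y^2, [x, y]>|. Here bc and ac have squares d, e and commutator d e f, which are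
    independent, while b and c generate a dihedral group of order 8. *)
Lemma sq1_indices :
  [&& A1_witness (gen_b sq1 * gen_c sq1) (gen_a sq1 * gen_c sq1) 2
    & A1_witness (gen_c sq1) (gen_b sq1) 8].
Proof. by vm_compute. Qed.

Lemma sq2_indices :
  [&& A1_witness (gen_b sq2 * gen_c sq2) (gen_a sq2 * gen_c sq2) 2
    & A1_witness (gen_b sq2) (gen_a sq2) 8].
Proof. by vm_compute. Qed.

Lemma sq3_indices :
  [&& A1_witness (gen_b sq3 * gen_c sq3) (gen_a sq3 * gen_c sq3) 2,
      A1_witness (gen_c sq3) (gen_b sq3) 4
    & nonabelian_order_ge sq3 16].
Proof. by vm_compute. Qed.

Lemma sq4_indices :
  [&& A1_witness (gen_b sq4 * gen_c sq4) (gen_a sq4) 2,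
      A1_witness (gen_c sq4) (gen_b sq4) 4
    & nonabelian_order_ge sq4 16].
Proof. by vm_compute. Qed.

(** The index 8 comes from a quaternion group, as a^2 = b^2 = [a, b] = f; the same holds for
    [sq6]. *)
Lemma sq5_indices :
  [&& A1_witness (gen_b sq5) (gen_a sq5 * gen_c sq5) 2
    & A1_witness (gen_b sq5) (gen_a sq5) 8].
Proof. by vm_compute. Qed.

Lemma sq6_indices :
  [&& A1_witness (gen_b sq6) (gen_a sq6 * gen_c sq6) 2
    & A1_witness (gen_b sq6) (gen_a sq6) 8].
Proof. by vm_compute. Qed.

Lemma sq7_indices :
  [&& A1_witness (gen_c sq7) (gen_a sq7 * gen_b sq7) 2,
      A1_witness (gen_c sq7) (gen_b sq7) 4
    & nonabelian_order_ge sq7 16].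
Proof. by vm_compute. Qed.

Lemma sq8_indices :
  [&& A1_witness (gen_c sq8) (gen_a sq8 * gen_b sq8) 2,
      A1_witness (gen_c sq8) (gen_b sq8) 4
    & nonabelian_order_ge sq8 16].
Proof. by vm_compute. Qed.

Lemma sq9_indices :
  [&& A1_witness (gen_c sq9) (gen_b sq9) 2,
      A1_witness (gen_c sq9) (gen_a sq9) 4
    & nonabelian_order_ge sq9 16].
Proof. by vm_compute. Qed.

(** The bound 32 means that x^2, y^2 and [x, y] are independent for every non-commuting pair. *)
Lemma sq10_indices :
  [&& A1_witness (gen_c sq10) (gen_b sq10) 2
    & nonabelian_order_ge sq10 32].
Proof. by vm_compute. Qed.

Lemma S1_Imax (gT : finGroupType) (G : {group gT}) : S1 G ->
  [/\ is_Imin G 1, ~ is_Imax G 2 & ~ is_Imax G 1].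
Proof.
move=> /S1_isog isoG; have /andP[w2 w8] := sq1_indices.
exact: (Imax_ne12 isoG w2 w8).
Qed.

Lemma S2_Imax (gT : finGroupType) (G : {group gT}) : S2 G ->
  [/\ is_Imin G 1, ~ is_Imax G 2 & ~ is_Imax G 1].
Proof.
move=> /S2_isog isoG; have /andP[w2 w8] := sq2_indices.
exact: (Imax_ne12 isoG w2 w8).
Qed.

Lemma S3_Imax (gT : finGroupType) (G : {group gT}) : S3 G ->
  [/\ is_Imin G 1, ~ is_Imax G 3 & ~ is_Imax G 1].
Proof.
move=> /S3_isog isoG; have /and3P[w2 w4 ge16] := sq3_indices.
exact: (Imax_ne13 isoG w2 w4 ge16).
Qed.

Lemma S4_Imax (gT : finGroupType) (G : {group gT}) : S4 G ->
  [/\ is_Imin G 1, ~ is_Imax G 3 & ~ is_Imax G 1].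
Proof.
move=> /S4_isog isoG; have /and3P[w2 w4 ge16] := sq4_indices.
exact: (Imax_ne13 isoG w2 w4 ge16).
Qed.

Lemma S5_Imax (gT : finGroupType) (G : {group gT}) : S5 G ->
  [/\ is_Imin G 1, ~ is_Imax G 2 & ~ is_Imax G 1].
Proof.
move=> /S5_isog isoG; have /andP[w2 w8] := sq5_indices.
exact: (Imax_ne12 isoG w2 w8).
Qed.

Lemma S6_Imax (gT : finGroupType) (G : {group gT}) : S6 G ->
  [/\ is_Imin G 1, ~ is_Imax G 2 & ~ is_Imax G 1].
Proof.
move=> /S6_isog isoG; have /andP[w2 w8] := sq6_indices.
exact: (Imax_ne12 isoG w2 w8).
Qed.

Lemma S7_Imax (gT : finGroupType) (G : {group gT}) : S7 G ->
  [/\ is_Imin G 1, ~ is_Imax G 3 & ~ is_Imax G 1].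
Proof.
move=> /S7_isog isoG; have /and3P[w2 w4 ge16] := sq7_indices.
exact: (Imax_ne13 isoG w2 w4 ge16).
Qed.

Lemma S8_Imax (gT : finGroupType) (G : {group gT}) : S8 G ->
  [/\ is_Imin G 1, ~ is_Imax G 3 & ~ is_Imax G 1].
Proof.
move=> /S8_isog isoG; have /and3P[w2 w4 ge16] := sq8_indices.
exact: (Imax_ne13 isoG w2 w4 ge16).
Qed.

Lemma S9_Imax (gT : finGroupType) (G : {group gT}) : S9 G ->
  [/\ is_Imin G 1, ~ is_Imax G 3 & ~ is_Imax G 1].
Proof.
move=> /S9_isog isoG; have /and3P[w2 w4 ge16] := sq9_indices.
exact: (Imax_ne13 isoG w2 w4 ge16).
Qed.

Lemma S10_Imax (gT : finGroupType) (G : {group gT}) : S10 G ->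
  [/\ is_Imin G 1, ~ is_Imax G 3 & ~ is_Imax G 2].
Proof.
move=> /S10_isog isoG; have /andP[w2 ge32] := sq10_indices.
exact: (Imax_ne23 isoG w2 ge32).
Qed.

Theorem theorem7p7 (gT : finGroupType) (G : {group gT})
    (hG : S1 G \/ S2 G \/ S3 G \/ S4 G \/ S5 G \/
          S6 G \/ S7 G \/ S8 G \/ S9 G \/ S10 G) :
  is_Imin G 1 /\
  (is_Imax G 3 -> S1 G \/ S2 G \/ S5 G \/ S6 G) /\
  (is_Imax G 2 -> S3 G \/ S4 G \/ S7 G \/ S8 G \/ S9 G) /\
  (is_Imax G 1 -> S10 G).
Proof.
case: hG => [h|[h|[h|[h|[h|[h|[h|[h|[h|h]]]]]]]]].
- have [Imin1 ne2 ne1] := S1_Imax h.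
  split; first exact: Imin1.
  split; first by move=> _; left; exact h.
  split; [case/ne2 | case/ne1].
- have [Imin1 ne2 ne1] := S2_Imax h.
  split; first exact: Imin1.
  split; first by move=> _; right; left; exact h.
  split; [case/ne2 | case/ne1].
- have [Imin1 ne3 ne1] := S3_Imax h.
  split; first exact: Imin1.
  split; first by case/ne3.
  split; [move=> _; left; exact h | case/ne1].
- have [Imin1 ne3 ne1] := S4_Imax h.
  split; first exact: Imin1.
  split; first by case/ne3.
  split; [move=> _; right; left; exact h | case/ne1].
- have [Imin1 ne2 ne1] := S5_Imax h.
  split; first exact: Imin1.
  split; first by move=> _; right; right; left; exact h.
  split; [case/ne2 | case/ne1].
- have [Imin1 ne2 ne1] := S6_Imax h.
  split; first exact: Imin1.
  split; first by move=> _; right; right; right; exact h.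
  split; [case/ne2 | case/ne1].
- have [Imin1 ne3 ne1] := S7_Imax h.
  split; first exact: Imin1.
  split; first by case/ne3.
  split; [move=> _; right; right; left; exact h | case/ne1].
- have [Imin1 ne3 ne1] := S8_Imax h.
  split; first exact: Imin1.
  split; first by case/ne3.
  split; [move=> _; right; right; right; left; exact h | case/ne1].
- have [Imin1 ne3 ne1] := S9_Imax h.
  split; first exact: Imin1.
  split; first by case/ne3.
  split; [move=> _; right; right; right; right; exact h | case/ne1].
- have [Imin1 ne3 ne2] := S10_Imax h.
  split; first exact: Imin1.
  split; first by case/ne3.
  split; [case/ne2 | move=> _; exact: h].
Qed.
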